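(* Let $\mathfrak{g}, \mathfrak{h}$ be two Leibniz algebras, let $\mathfrak{h}$ be a Leibniz $\mathfrak{g}$-representation, and let $T: \mathfrak{h} \rightarrow \mathfrak{g}$ be a $\lambda$-weighted relative Rota-Baxter operator. If $T_t = \sum_{i=0}^\infty t^i T_i$ is a formal deformation of $T$, then $T_1$ is a $1$-cocycle in the cohomology complex of $T$. Moreover, the corresponding cohomology class (in $H^1_{\mathrm{Leib}}(\mathfrak{h}_T,\mathfrak{g})$) depends only on the equivalence class of the deformation $T_t$; that is, if $T_t=\sum_{i\ge 0} t^iT_i$ and $T'_t=\sum_{i\ge 0} t^iT'_i$ are equivalent formal deformations of $T$, then $T_1$ and $T_1'$ are cohomologous.
   Context: All vector spaces and (multi)linear maps are over a field $\mathbf{k}$ of characteristic $0$, and $\lambda \in \mathbf{k}$ is a fixed scalar. A (left) Leibniz algebra is a vector space $\mathfrak{g}$ with a bilinear bracket $[~,~]_\mathfrak{g}$ satisfying $[x,[y,z]_\mathfrak{g}]_\mathfrak{g} = [[x,y]_\mathfrak{g},z]_\mathfrak{g} + [y,[x,z]_\mathfrak{g}]_\mathfrak{g}$ for all $x,y,z$. A representation of $\mathfrak{g}$ is a vector space $V$ with bilinear maps $\rho^L : \mathfrak{g}\otimes V \to V$, $\rho^R : V \otimes \mathfrak{g} \to V$ such that for $x,y\in\mathfrak{g}$, $v \in V$: $\rho^L(x,\rho^L(y,v)) = \rho^L([x,y]_\mathfrak{g},v) + \rho^L(y,\rho^L(x,v))$; $\rho^L(x,\rho^R(v,y)) = \rho^R(\rho^L(x,v),y)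 + \rho^R(v,[x,y]_\mathfrak{g})$; $\rho^R(v,[x,y]_\mathfrak{g}) = \rho^R(\rho^R(v,x),y) + \rho^L(x,\rho^R(v,y))$. A Leibniz algebra $\mathfrak{h}$ is a Leibniz $\mathfrak{g}$-representation if it has maps $\rho^L,\rho^R$ making it a representation of $\mathfrak{g}$ and, for $u,v\in\mathfrak{h}$, $x\in\mathfrak{g}$: $[u,\rho^R(v,x)]_\mathfrak{h} = \rho^R([u,v]_\mathfrak{h},x) + [v,\rho^R(u,x)]_\mathfrak{h}$; $[u,\rho^L(x,v)]_\mathfrak{h} = [\rho^R(u,x),v]_\mathfrak{h} + \rho^L(x,[u,v]_\mathfrak{h})$; $\rho^L(x,[u,v]_\mathfrak{h}) = [\rho^L(x,u),v]_\mathfrak{h} + [u,\rho^L(x,v)]_\mathfrak{h}$. A linear map $T:\mathfrak{h}\to\mathfrak{g}$ is a $\lambda$-weighted relative Rota-Baxter operator if $[Tu,Tv]_\mathfrak{g} = T(\rho^L(Tu,v)+\rho^R(u,Tv)+\lambda[u,v]_\mathfrak{h})$ for all $u,v\in\mathfrak{h}$. A morphism from $T$ to $T'$ (two such operators $\mathfrak{h}\to\mathfrak{g}$) is a pair $(\phi,\psi)$ of Leibniz algebra morphisms $\phi:\mathfrak{g}\to\mathfrak{g}$, $\psi:\mathfrak{h}\to\mathfrak{h}$ with $\phi\circ T=T'\circ\psi$, $\psi(\rho^L(x,u))=\rho^L(\phi(x),\psi(u))$ and $\psi(\rho^R(u,x))=\rho^R(\psi(u),\phi(x))$ for all $x\in\mathfrak{g}$,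 $u\in\mathfrak{h}$. Cohomology complex of $T$: let $\mathfrak{h}_T$ be the Leibniz algebra $\mathfrak{h}$ with bracket $[u,v]_T = \rho^L(Tu,v)+\rho^R(u,Tv)+\lambda[u,v]_\mathfrak{h}$; it has a representation on $\mathfrak{g}$ given by $\varrho^L(u,x)=[Tu,x]_\mathfrak{g}-T(\rho^R(u,x))$, $\varrho^R(x,u)=[x,Tu]_\mathfrak{g}-T(\rho^L(x,u))$. The cochain groups are $C^n_{\mathrm{Leib}}(\mathfrak{h}_T,\mathfrak{g})=\mathrm{Hom}(\mathfrak{h}^{\otimes n},\mathfrak{g})$, $n\ge 0$, with differential $$(\delta_{\mathrm{Leib}}f)(u_1,\ldots,u_{n+1}) = \sum_{i=1}^n(-1)^{i+1}\varrho^L(u_i,f(u_1,\ldots,\widehat{u_i},\ldots,u_{n+1})) + (-1)^{n+1}\varrho^R(f(u_1,\ldots,u_n),u_{n+1}) + \sum_{1\le i<j\le n+1}(-1)^i f(u_1,\ldots,\widehat{u_i},\ldots,u_{j-1},[u_i,u_j]_T,u_{j+1},\ldots,u_{n+1}).$$ Its cohomology groups $H^n_{\mathrm{Leib}}(\mathfrak{h}_T,\mathfrak{g})$ are the cohomology groups of $T$. Formal deformations: the Leibniz structures on $\mathfrak{g},\mathfrak{h}$ and the actions extend $\mathbf{k}[[t]]$-bilinearly to $\mathfrak{g}[[t]],\mathfrak{h}[[t]]$. A formal deformation of $T$ is a formal sum $T_t=\sum_{i\ge 0}t^iT_i\in\mathrm{Hom}(\mathfrak{h},\mathfrak{g})[[t]]$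 with $T_0=T$ such that the $\mathbf{k}[[t]]$-linear map $T_t:\mathfrak{h}[[t]]\to\mathfrak{g}[[t]]$ is a $\lambda$-weighted relative Rota-Baxter operator. Two formal deformations $T_t,T_t'$ of $T$ are equivalent if there exist $x_0\in\mathfrak{g}$ and linear maps $\phi_i\in\mathrm{Hom}(\mathfrak{g},\mathfrak{g})$, $\psi_i\in\mathrm{Hom}(\mathfrak{h},\mathfrak{h})$, $i\ge 2$, such that the pair $\big(\Phi_t=\mathrm{id}_\mathfrak{g}+t[x_0,-]_\mathfrak{g}+\sum_{i\ge2}t^i\phi_i,\ \Psi_t=\mathrm{id}_\mathfrak{h}+t\rho^L(x_0,-)+\sum_{i\ge2}t^i\psi_i\big)$ of $\mathbf{k}[[t]]$-linear maps is a morphism of $\lambda$-weighted relative Rota-Baxter operators from $T_t$ to $T_t'$. *)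

(* Defs.v *)
From HB Require Import structures.
From mathcomp Require Import all_boot all_algebra.
From mathcomp Require Import boolp.

Set Implicit Arguments.
Unset Strict Implicit.
Unset Printing Implicit Defensive.

Import GRing.Theory.
Local Open Scope ring_scope.

(* Leibniz algebras and their representations are defined over an arbitrary
   commutative ring: they are used over the field k and over k[[t]]. *)

HB.mixin Record Lmodule_isLeibniz (R : comNzRingType) L
    of GRing.Lmodule R L := {
  lbracket : {bilinear L -> L -> L};
  lbracketA : forall x y z : L,
    lbracket x (lbracket y z) =
    lbracket (lbracket x y) z + lbracket y (lbracket x z)
}.

#[short(type="leibnizType")]
HB.structure Definition Leibniz (R : comNzRingType) :=
  {L of GRing.Lmodule R L & Lmodule_isLeibniz R L}.

Notation "⟦ x , y ⟧" := (lbracket x y)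
  (at level 0, x, y at level 99, format "⟦ x ,  y ⟧") : ring_scope.

Section Representations.
Variable R : comNzRingType.

Record representation (g : leibnizType R) (V : lmodType R) := Representation {
  repL : {bilinear g -> V -> V};
  repR : {bilinear V -> g -> V};
  repLL : forall (x y : g) (v : V),
    repL x (repL y v) = repL ⟦x, y⟧ v + repL y (repL x v);
  repLR : forall (x y : g) (v : V),
    repL x (repR v y) = repR (repL x v) y + repR v ⟦x, y⟧;
  repRR : forall (x y : g) (v : V),
    repR v ⟦x, y⟧ = repR (repR v x) y + repL x (repR v y)
}.

Record leibnizRep (g h : leibnizType R) := LeibnizRep {
  leibnizRep_rep :> representation g h;
  brepR : forall (u v : h) (x : g),
    ⟦u, repR leibnizRep_rep v x⟧ =
    repR leibnizRep_rep ⟦u, v⟧ x + ⟦v, repR leibnizRep_rep u x⟧;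
  brepL : forall (u v : h) (x : g),
    ⟦u, repL leibnizRep_rep x v⟧ =
    ⟦repR leibnizRep_rep u x, v⟧ + repL leibnizRep_rep x ⟦u, v⟧;
  repLb : forall (u v : h) (x : g),
    repL leibnizRep_rep x ⟦u, v⟧ =
    ⟦repL leibnizRep_rep x u, v⟧ + ⟦u, repL leibnizRep_rep x v⟧
}.

Definition leibniz_morphism (L L' : leibnizType R) (f : {linear L -> L'}) :=
  forall x y : L, f ⟦x, y⟧ = ⟦f x, f y⟧.

Section RotaBaxter.
Variables (g h : leibnizType R) (rho : leibnizRep g h).

Definition is_relRB (lam : R) (T : {linear h -> g}) :=
  forall u v : h,
    ⟦T u, T v⟧ = T (repL rho (T u) v + repR rho u (T v) + lam *: ⟦u, v⟧).

Record relRB (lam : R) := RelRB {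
  relRB_map :> {linear h -> g};
  relRBP : is_relRB lam relRB_map
}.

Definition relRB_morphism (T T' : {linear h -> g})
    (phi : {linear g -> g}) (psi : {linear h -> h}) :=
  [/\ leibniz_morphism phi, leibniz_morphism psi,
      forall u : h, phi (T u) = T' (psi u),
      forall (x : g) (u : h), psi (repL rho x u) = repL rho (phi x) (psi u)
    & forall (x : g) (u : h), psi (repR rho u x) = repR rho (psi u) (phi x)].

End RotaBaxter.
End Representations.

Section Cohomology.
Variables (R : comNzRingType) (L : leibnizType R) (V : lmodType R).
Variable rho : representation L V.

Definition fupd n (u : {ffun 'I_n -> L}) (i : 'I_n) (x : L) :=
  [ffun j => if j == i then x else u j].

Definition fdel n (u : {ffun 'I_n.+1 -> L}) (i : 'I_n.+1) :=
  [ffun j : 'I_n => u (lift i j)].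

Definition multilinear n (f : {ffun 'I_n -> L} -> V) :=
  forall (u : {ffun 'I_n -> L}) (i : 'I_n), linear (fun x => f (fupd u i x)).

(* The arguments u_1, ..., u_{n+1} are numbered from 0, which shifts the
   exponent of the sign (-1)^i by one in both sums. In the first sum the last
   index ord_max is excluded. *)
Definition leib_diff n (f : {ffun 'I_n -> L} -> V) (u : {ffun 'I_n.+1 -> L}) :=
  \sum_(i < n.+1 | (i < n)%N) (-1) ^+ i *: repL rho (u i) (f (fdel u i))
  + (-1) ^+ n.+1 *: repR rho (f (fdel u ord_max)) (u ord_max)
  + \sum_(i < n.+1) \sum_(j < n.+1 | (i < j)%N)
      (-1) ^+ i.+1 *: f (fdel (fupd u j ⟦u i, u j⟧) i).

Definition cocycle n (f : {ffun 'I_n -> L} -> V) :=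
  multilinear f /\ forall u, leib_diff f u = 0.

Definition cohomologous n (f f' : {ffun 'I_n.+1 -> L} -> V) :=
  [/\ cocycle f, cocycle f'
    & exists2 c : {ffun 'I_n -> L} -> V,
        multilinear c & forall u, f u - f' u = leib_diff c u].

End Cohomology.

Section Induced.
Variables (R : comNzRingType) (g h : leibnizType R) (rho : leibnizRep g h).
Variables (lam : R) (T : relRB rho lam).

Definition induced_bracket (u v : h) : h :=
  repL rho (T u) v + repR rho u (T v) + lam *: ⟦u, v⟧.

Definition induced_repL (u : h) (x : g) : g := ⟦T u, x⟧ - T (repR rho u x).

Definition induced_repR (x : g) (u : h) : g := ⟦x, T u⟧ - T (repL rho x u).

Fact induced_bracket_bilinear : bilinear_for *:%R *:%R induced_bracket.
Proof.
have sAC (a : R) (x1 x2 y1 y2 z1 z2 : h) :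
    (a *: x1 + x2) + (a *: y1 + y2) + lam *: (a *: z1 + z2) =
    a *: (x1 + y1 + lam *: z1) + (x2 + y2 + lam *: z2).
  rewrite !scalerDr !scalerA [a * lam]mulrC.
  by rewrite !addrA [LHS](ACl (1*3*5*2*4*6)%AC).
split=> w a u v; rewrite /induced_bracket (linearP T).
  by rewrite !linearPl; exact: sAC.
by rewrite !linearPr; exact: sAC.
Qed.

Fact induced_repL_bilinear : bilinear_for *:%R *:%R induced_repL.
Proof.
have sAC (a : R) (x1 x2 y1 y2 : g) :
    (a *: x1 + x2) - (a *: y1 + y2) = a *: (x1 - y1) + (x2 - y2).
  by rewrite scalerBr opprD addrACA.
split=> w a u v; rewrite /induced_repL.
  by rewrite (linearP T) !linearPl (linearP T); exact: sAC.
by rewrite !linearPr (linearP T); exact: sAC.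
Qed.

Fact induced_repR_bilinear : bilinear_for *:%R *:%R induced_repR.
Proof.
have sAC (a : R) (x1 x2 y1 y2 : g) :
    (a *: x1 + x2) - (a *: y1 + y2) = a *: (x1 - y1) + (x2 - y2).
  by rewrite scalerBr opprD addrACA.
split=> w a u v; rewrite /induced_repR.
  by rewrite !linearPl (linearP T); exact: sAC.
by rewrite (linearP T) !linearPr (linearP T); exact: sAC.
Qed.

Lemma relRB_induced u v : T (induced_bracket u v) = ⟦T u, T v⟧.
Proof. by rewrite (relRBP T). Qed.

Fact induced_leibniz u v w :
  induced_bracket u (induced_bracket v w) =
  induced_bracket (induced_bracket u v) w +
  induced_bracket v (induced_bracket u w).
Proof.
rewrite {1}/induced_bracket [X in _ = X + _]/induced_bracket.
rewrite [X in _ = _ + X]/induced_bracket !relRB_induced /induced_bracket.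
rewrite !(linearDr, linearDl) !(linearZr_LR, linearZl_LR) /=.
rewrite !scalerDr !scalerA.
rewrite (repLL rho) (repLR rho) [repR rho u _](repRR rho).
rewrite (brepL rho) (brepR rho) (repLb rho) lbracketA.
rewrite !scalerDr !addrA.
by rewrite [LHS](ACl (1*3*7*11*5*9*13*2*8*10*4*6*12*14)%AC).
Qed.

Let subT a p q : a - T p - T q = a - T (p + q).
Proof. by rewrite (linearD T) opprD addrA. Qed.

Let addT a b p q : (a - T p) + (b - T q) = a + b - T (p + q).
Proof. by rewrite (linearD T) opprD addrACA. Qed.

Let induced_repLB u x y :
  induced_repL u (x - y) = induced_repL u x - induced_repL u y.
Proof.
by rewrite /induced_repL !linearBr (linearB T) !opprD !opprK addrACA.
Qed.

Let induced_repRB u x y :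
  induced_repR (x - y) u = induced_repR x u - induced_repR y u.
Proof.
by rewrite /induced_repR !linearBl (linearB T) !opprD !opprK addrACA.
Qed.

Let induced_repLT u v :
  induced_repL u (T v) = T (repL rho (T u) v + lam *: ⟦u, v⟧).
Proof.
rewrite /induced_repL (relRBP T) -(linearB T); congr (T _).
by rewrite [LHS]addrAC addrK.
Qed.

Let induced_repRT u v :
  induced_repR (T v) u = T (repR rho v (T u) + lam *: ⟦v, u⟧).
Proof.
rewrite /induced_repR (relRBP T) -(linearB T); congr (T _).
by rewrite -[X in X - _]addrA [LHS]addrAC subrr add0r.
Qed.

Let repLE u x : induced_repL u x = ⟦T u, x⟧ - T (repR rho u x).
Proof. by []. Qed.

Let repRE x u : induced_repR x u = ⟦x, T u⟧ - T (repL rho x u).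
Proof. by []. Qed.

Fact induced_repLL u v x :
  induced_repL u (induced_repL v x) =
  induced_repL (induced_bracket u v) x + induced_repL v (induced_repL u x).
Proof.
rewrite (repLE v x) (repLE u x) !induced_repLB !induced_repLT.
rewrite /induced_repL relRB_induced.
rewrite !subT addT -lbracketA; congr (_ - T _).
rewrite /induced_bracket (repLR rho) (repRR rho) (brepR rho).
rewrite !(linearDl, linearZl_LR) /= !scalerDr !addrA.
by rewrite [LHS](ACl (3*1*5*4*2*6)%AC).
Qed.

Fact induced_repLR u v x :
  induced_repL u (induced_repR x v) =
  induced_repR (induced_repL u x) v + induced_repR x (induced_bracket u v).
Proof.
rewrite (repRE x v) (repLE u x) induced_repLB induced_repRB.
rewrite induced_repLT induced_repRT /induced_repL /induced_repR relRB_induced.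
rewrite !subT addT -lbracketA; congr (_ - T _).
rewrite /induced_bracket (repLL rho) (repRR rho) (brepL rho).
rewrite !(linearDr, linearZr_LR) /= !scalerDr !addrA.
by rewrite [LHS](ACl (3*1*5*4*2*6)%AC).
Qed.

Fact induced_repRR u v x :
  induced_repR x (induced_bracket u v) =
  induced_repR (induced_repR x u) v + induced_repL u (induced_repR x v).
Proof.
rewrite (repRE x u) (repRE x v) induced_repLB induced_repRB.
rewrite induced_repLT induced_repRT /induced_repL /induced_repR relRB_induced.
rewrite !subT addT -lbracketA; congr (_ - T _).
rewrite /induced_bracket !(linearDr, linearZr_LR) /=.
rewrite (repLL rho x) (repLR rho x) (repLb rho) !scalerDr !addrA.
by rewrite [LHS](ACl (1*3*5*4*2*6)%AC).
Qed.

(* The Leibniz algebra h_T: the space h with the bracket [ , ]_T. *)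
Definition induced of relRB rho lam : Type := h.

HB.instance Definition _ := GRing.Lmodule.on (induced T).

HB.instance Definition _ := @bilinear_isBilinear.Build R
  (induced T) (induced T) (induced T) *:%R *:%R
  (induced_bracket : induced T -> induced T -> induced T)
  induced_bracket_bilinear.

HB.instance Definition _ := @Lmodule_isLeibniz.Build R (induced T)
  (induced_bracket : {bilinear induced T -> induced T -> induced T})
  induced_leibniz.

HB.instance Definition _ := @bilinear_isBilinear.Build R
  (induced T) g g *:%R *:%R
  (induced_repL : induced T -> g -> g)
  induced_repL_bilinear.

HB.instance Definition _ := @bilinear_isBilinear.Build R
  g (induced T) g *:%R *:%R
  (induced_repR : g -> induced T -> g)
  induced_repR_bilinear.

Definition induced_rep : representation (induced T) g :=
  @Representation R (induced T) g
    (induced_repL : {bilinear induced T -> g -> g})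
    (induced_repR : {bilinear g -> induced T -> g})
    induced_repLL induced_repLR induced_repRR.

End Induced.

(* V[[t]]; pscoef f n is the coefficient of t^n. *)
Record powser (V : Type) := Powser { pscoef : nat -> V }.

HB.instance Definition _ V := [isNew for @pscoef V].
HB.instance Definition _ (V : choiceType) := [Choice of powser V by <:].

Lemma psP V (a b : powser V) : (forall n, pscoef a n = pscoef b n) <-> a = b.
Proof.
split=> [eqab | -> //]; case: a b eqab => [a] [b] /= eqab.
by congr Powser; apply/funext.
Qed.

Section PowserZmodule.
Variable V : zmodType.
Implicit Types a b c : powser V.

Definition ps0 : powser V := Powser (fun=> 0).
Definition psadd a b := Powser (fun n => pscoef a n + pscoef b n).
Definition psopp a := Powser (fun n => - pscoef a n).

Fact psaddA : associative psadd.
Proof. by move=> a b c; apply/psP => n; apply: addrA. Qed.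
Fact psaddC : commutative psadd.
Proof. by move=> a b; apply/psP => n; apply: addrC. Qed.
Fact psadd0 : left_id ps0 psadd.
Proof. by move=> a; apply/psP => n; apply: add0r. Qed.
Fact psaddN : left_inverse ps0 psopp psadd.
Proof. by move=> a; apply/psP => n; apply: addNr. Qed.

HB.instance Definition _ :=
  GRing.isZmodule.Build (powser V) psaddA psaddC psadd0 psaddN.

Lemma pscoefD a b n : pscoef (a + b) n = pscoef a n + pscoef b n.
Proof. by []. Qed.

End PowserZmodule.

(* The extension of an operation B, of the type of a bilinear map, to formal
   power series by convolution. *)
Definition psconv U V (W : zmodType) (B : U -> V -> W)
    (a : powser U) (b : powser V) : powser W :=
  Powser (fun n => \sum_(i < n.+1) B (pscoef a i) (pscoef b (n - i))).

Lemma psconvDl (U : zmodType) V (W : zmodType) (B : U -> V -> W) b :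
    (forall y, {morph B^~ y : x x' / x + x'}) ->
  {morph (psconv B)^~ b : a a' / a + a'}.
Proof.
move=> BD a a'; apply/psP => n; rewrite pscoefD /= -big_split.
by apply: eq_bigr => i _; apply: BD.
Qed.

Lemma psconvDr U (V W : zmodType) (B : U -> V -> W) a :
    (forall x, {morph B x : y y' / y + y'}) ->
  {morph psconv B a : b b' / b + b'}.
Proof.
move=> BD b b'; apply/psP => n; rewrite pscoefD /= -big_split.
by apply: eq_bigr => i _; apply: BD.
Qed.

Lemma psconvE U V (W : zmodType) (B : U -> V -> W) a b n N : (n < N)%N ->
  pscoef (psconv B a b) n =
  \sum_(i < N) \sum_(j < N | (i + j == n)%N) B (pscoef a i) (pscoef b j).
Proof.
move=> ltnN; rewrite /=.
rewrite (big_ord_widen _ (fun i => B (pscoef a i) (pscoef b (n - i))) ltnN).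
rewrite big_mkcond /=.
apply: eq_bigr => i _; rewrite ltnS; case: leqP => [le_in | lt_ni].
  have ltN : (n - i < N)%N by apply: leq_ltn_trans ltnN; apply: leq_subr.
  rewrite (big_pred1 (Ordinal ltN)) // => j /=.
  by rewrite -val_eqE /= -[RHS](eqn_add2l i) subnKC.
by rewrite big1 // => j /eqP def_n; rewrite -def_n ltnNge leq_addr in lt_ni.
Qed.

Lemma psconvC U V (W : zmodType) (B : U -> V -> W) a b :
  psconv B a b = psconv (fun y x => B x y) b a.
Proof.
apply/psP => n; rewrite (psconvE B a b (ltnSn n)).
rewrite (psconvE (fun y x => B x y) b a (ltnSn n)).
rewrite (exchange_big_dep xpredT) //=; apply: eq_bigr => j _.
by apply: eq_bigl => i; rewrite addnC.
Qed.

(* Iterated convolutions as sums over triples of exponents. *)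
Lemma psconv3r A B C (D E : zmodType)
    (P : A -> D -> E) (Q : B -> C -> D) a b c n :
    (forall x, P x 0 = 0) -> (forall x, {morph P x : y y' / y + y'}) ->
  pscoef (psconv P a (psconv Q b c)) n =
  \sum_(i < n.+1) \sum_(j < n.+1) \sum_(l < n.+1 | (i + j + l == n)%N)
    P (pscoef a i) (Q (pscoef b j) (pscoef c l)).
Proof.
move=> P0 PD; rewrite (psconvE _ _ _ (ltnSn n)); apply: eq_bigr => i _.
under eq_bigr => m _.
  rewrite (psconvE _ _ _ (ltn_ord m)) (big_morph _ (PD _) (P0 _)).
  under eq_bigr do rewrite (big_morph _ (PD _) (P0 _)).
  over.
rewrite exchange_big; apply: eq_bigr => j _ /=.
rewrite (exchange_big_dep xpredT) //= [RHS]big_mkcond; apply: eq_bigr => l _ /=.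
case: eqP => [def_n | ne_n].
  have ltn_jl : (j + l < n.+1)%N.
    by have:= leq_addl i (j + l); rewrite addnA def_n.
  rewrite (big_pred1 (Ordinal ltn_jl)) // => m /=.
  rewrite -val_eqE /= [(j + l == m)%N]eq_sym andbC.
  by case: eqP => //= ->; rewrite addnA def_n eqxx.
rewrite big1 // => m /andP[/eqP def_n /eqP def_m].
by rewrite -def_m addnA in def_n.
Qed.

Lemma psconv3l A B C (D E : zmodType)
    (P : D -> C -> E) (Q : A -> B -> D) a b c n :
    (forall y, P 0 y = 0) -> (forall y, {morph P^~ y : x x' / x + x'}) ->
  pscoef (psconv P (psconv Q a b) c) n =
  \sum_(i < n.+1) \sum_(j < n.+1) \sum_(l < n.+1 | (i + j + l == n)%N)
    P (Q (pscoef a i) (pscoef b j)) (pscoef c l).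
Proof.
move=> P0 PD; rewrite psconvC [psconv Q a b]psconvC psconv3r //.
under eq_bigr do under eq_bigr do rewrite big_mkcond /=.
rewrite exchange_big; under eq_bigr do rewrite exchange_big.
rewrite exchange_big; apply: eq_bigr => i _; apply: eq_bigr => j _ /=.
rewrite [RHS]big_mkcond; apply: eq_bigr => l _ /=.
by rewrite [(l + j)%N]addnC addnC addnA.
Qed.

Section Extension.
Variable R : comNzRingType.

Definition psC (V : zmodType) (x : V) : powser V :=
  Powser (fun n => if n == 0%N then x else 0).

Lemma psconv_psCl (U V W : zmodType) (B : U -> V -> W) x b n :
    (forall y, B 0 y = 0) ->
  pscoef (psconv B (psC x) b) n = B x (pscoef b n).
Proof.
by move=> B0; rewrite /= big_ord_recl /= subn0 big1 ?addr0 // => i _; apply: B0.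
Qed.

Lemma psconvA A B C (D D' E : zmodType) (P : D -> C -> E) (Q : A -> B -> D)
    (P' : A -> D' -> E) (Q' : B -> C -> D') a b c :
    (forall y, P 0 y = 0) -> (forall y, {morph P^~ y : x x' / x + x'}) ->
    (forall x, P' x 0 = 0) -> (forall x, {morph P' x : y y' / y + y'}) ->
    (forall x y z, P (Q x y) z = P' x (Q' y z)) ->
  psconv P (psconv Q a b) c = psconv P' a (psconv Q' b c).
Proof.
move=> P0 PD P'0 P'D eqPQ; apply/psP => n; rewrite psconv3l // psconv3r //.
by do 3![apply: eq_bigr => ? _]; apply: eqPQ.
Qed.

Lemma psconvCA A B C (D D' E : zmodType) (P : A -> D -> E) (Q : B -> C -> D)
    (P' : B -> D' -> E) (Q' : A -> C -> D') a b c :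
    (forall x, P x 0 = 0) -> (forall x, {morph P x : y y' / y + y'}) ->
    (forall x, P' x 0 = 0) -> (forall x, {morph P' x : y y' / y + y'}) ->
    (forall x y z, P x (Q y z) = P' y (Q' x z)) ->
  psconv P a (psconv Q b c) = psconv P' b (psconv Q' a c).
Proof.
move=> P0 PD P'0 P'D eqPQ; apply/psP => n; rewrite !psconv3r // exchange_big.
apply: eq_bigr => j _; apply: eq_bigr => i _ /=.
by rewrite addnC; apply: eq_bigr => l _; apply: eqPQ.
Qed.

Definition psmul : powser R -> powser R -> powser R := psconv *%R.

Fact psmulA : associative psmul.
Proof.
move=> a b c; symmetry; apply: psconvA => [||||x y z].
- exact: mul0r.
- by move=> y x x'; apply: mulrDl.
- exact: mulr0.
- by move=> x y y'; apply: mulrDr.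
- by rewrite mulrA.
Qed.
Fact psmulC : commutative psmul.
Proof.
move=> a b; rewrite /psmul psconvC; apply/psP => n /=.
by apply: eq_bigr => i _; apply: mulrC.
Qed.
Fact psmul1 : left_id (psC 1) psmul.
Proof.
move=> a; apply/psP => n; rewrite psconv_psCl ?mul1r // => y; exact: mul0r.
Qed.
Fact psmulDl : left_distributive psmul +%R.
Proof. by move=> a a' b; apply: psconvDl => y x x'; apply: mulrDl. Qed.
Fact ps1_neq0 : psC (1 : R) != 0.
Proof.
apply/eqP => /psP /(_ 0%N) /= /eqP; exact/negP/oner_neq0.
Qed.

HB.instance Definition _ :=
  GRing.Zmodule_isComNzRing.Build (powser R)
    psmulA psmulC psmul1 psmulDl ps1_neq0.

Section PowserLmodule.
Variable V : lmodType R.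

Definition psscale (c : powser R) (v : powser V) : powser V := psconv *:%R c v.

Fact psscaleA a b v : psscale a (psscale b v) = psscale (a * b) v.
Proof.
symmetry; apply: psconvA => [||||x y z].
- exact: scale0r.
- by move=> y x x'; apply: scalerDl.
- exact: scaler0.
- by move=> x y y'; apply: scalerDr.
- by rewrite scalerA.
Qed.
Fact psscale1 : left_id 1 psscale.
Proof.
move=> v; apply/psP => n; rewrite psconv_psCl ?scale1r // => y; exact: scale0r.
Qed.
Fact psscaleDr : right_distributive psscale +%R.
Proof. by move=> c v v'; apply: psconvDr => x y y'; apply: scalerDr. Qed.
Fact psscaleDl v : {morph psscale^~ v : a b / a + b}.
Proof. by move=> a b; apply: psconvDl => y x x'; apply: scalerDl. Qed.

HB.instance Definition _ := GRing.Zmodule_isLmodule.Build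
  (powser R) (powser V) psscaleA psscale1 psscaleDr psscaleDl.

End PowserLmodule.

Fact psconv_bilinear (U V W : lmodType R) (B : {bilinear U -> V -> W}) :
  bilinear_for *:%R *:%R (psconv B : powser U -> powser V -> powser W).
Proof.
split=> b c u v.
  rewrite psconvDl; last exact: linearDl.
  congr (_ + _); apply: psconvA => [||||x y z].
  - exact: linear0l.
  - exact: linearDl.
  - exact: scaler0.
  - by move=> x y y'; apply: scalerDr.
  - by rewrite linearZl_LR.
rewrite psconvDr; last exact: linearDr.
congr (_ + _); apply: psconvCA => [||||x y z].
- exact: linear0r.
- exact: linearDr.
- exact: scaler0.
- by move=> x y y'; apply: scalerDr.
- by rewrite linearZr_LR.
Qed.

HB.instance Definition _ (U V W : lmodType R) (B : {bilinear U -> V -> W}) :=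
  @bilinear_isBilinear.Build (powser R) (powser U) (powser V) (powser W)
    *:%R *:%R (psconv B) (psconv_bilinear B).

(* The k[[t]]-linear map U[[t]] -> V[[t]] given by an element of
   Hom(U, V)[[t]]. *)
Definition psmap (U V : lmodType R) (F : powser {linear U -> V})
  : powser U -> powser V := psconv (fun (f : {linear U -> V}) x => f x) F.

Fact psmap_linear (U V : lmodType R) (F : powser {linear U -> V}) :
  linear (psmap F).
Proof.
move=> c u v; rewrite /psmap psconvDr => [|f x y]; last exact: linearD.
congr (_ + _); apply: psconvCA => [||||f x y].
- by move=> f; apply: linear0.
- by move=> f x y; apply: linearD.
- exact: scaler0.
- by move=> x y y'; apply: scalerDr.
- exact: linearZ.
Qed.

HB.instance Definition _ (U V : lmodType R) (F : powser {linear U -> V}) :=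
  GRing.isLinear.Build (powser R) (powser U) (powser V) *:%R
    (psmap F) (psmap_linear F).

Lemma psconv_leibniz (A B C D1 D2 D3 E : lmodType R)
    (P1 : {bilinear A -> D1 -> E}) (Q1 : B -> C -> D1)
    (P2 : {bilinear D2 -> C -> E}) (Q2 : A -> B -> D2)
    (P3 : {bilinear B -> D3 -> E}) (Q3 : A -> C -> D3) a b c :
    (forall x y z, P1 x (Q1 y z) = P2 (Q2 x y) z + P3 y (Q3 x z)) ->
  psconv P1 a (psconv Q1 b c) =
  psconv P2 (psconv Q2 a b) c + psconv P3 b (psconv Q3 a c).
Proof.
move=> eqPQ; apply/psP => n; rewrite pscoefD.
rewrite (psconv3r _ _ _ _ _ (linear0r P1) (linearDr P1)).
rewrite (psconv3l _ _ _ _ _ (linear0l P2) (linearDl P2)).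
rewrite (psconv3r _ _ _ _ _ (linear0r P3) (linearDr P3)).
rewrite [X in _ = _ + X]exchange_big -big_split; apply: eq_bigr => i _ /=.
rewrite -big_split; apply: eq_bigr => j _ /=.
rewrite [(j + i)%N]addnC -big_split; apply: eq_bigr => l _; exact: eqPQ.
Qed.

HB.instance Definition _ (L : leibnizType R) :=
  @Lmodule_isLeibniz.Build (powser R) (powser L)
    (psconv lbracket : {bilinear powser L -> powser L -> powser L})
    (fun a b c => psconv_leibniz a b c (@lbracketA R L)).

Definition ps_rep (g : leibnizType R) (V : lmodType R)
    (rho : representation g V) : representation (powser g) (powser V) :=
  @Representation (powser R) (powser g) (powser V)
    (psconv (repL rho) : {bilinear powser g -> powser V -> powser V})
    (psconv (repR rho) : {bilinear powser V -> powser g -> powser V})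
    (fun a b v => psconv_leibniz a b v (repLL rho))
    (fun a b v => psconv_leibniz a v b (fun x v y => repLR rho x y v))
    (fun a b v => psconv_leibniz v a b (fun v x y => repRR rho x y v)).

Definition ps_leibnizRep (g h : leibnizType R) (rho : leibnizRep g h)
  : leibnizRep (powser g) (powser h) :=
  @LeibnizRep (powser R) (powser g) (powser h) (ps_rep rho)
    (fun u v a => psconv_leibniz u v a (@brepR R g h rho))
    (fun u v a => psconv_leibniz u a v (fun u x v => brepL rho u v x))
    (fun u v a => psconv_leibniz a u v (fun x u v => repLb rho u v x)).

End Extension.

Section Deformations.
Variables (R : comNzRingType) (g h : leibnizType R) (rho : leibnizRep g h).
Variables (lam : R) (T : relRB rho lam).

Definition formal_deformation (Tt : powser {linear h -> g}) :=
  pscoef Tt 0%N =1 T /\ is_relRB (ps_leibnizRep rho) (psC lam) (psmap Tt).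

(* The coefficients of Phi and Psi of index at least 2 are arbitrary. *)
Definition equivalent_deformations (Tt Tt' : powser {linear h -> g}) :=
  exists (x0 : g) (Phi : powser {linear g -> g}) (Psi : powser {linear h -> h}),
    [/\ pscoef Phi 0%N =1 id, pscoef Phi 1%N =1 (fun x => ⟦x0, x⟧),
        pscoef Psi 0%N =1 id, pscoef Psi 1%N =1 (fun u => repL rho x0 u)
      & relRB_morphism (ps_leibnizRep rho)
          (psmap Tt) (psmap Tt') (psmap Phi) (psmap Psi)].

(* Hom(h, g) as the space of 1-cochains. *)
Definition cochain1 (f : {linear h -> g}) : {ffun 'I_1 -> induced T} -> g :=
  fun u => f (u ord0).

End Deformations.

Arguments cochain1 {R g h rho lam} T f u.

(* Main.v *)
Require Import Defs.
From mathcomp Require Import all_boot all_algebra.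

(** The theorem is a comparison of coefficients of [t]. Every identity between
    power series that defines a deformation or an equivalence is evaluated on
    constant series, where its coefficient of [t] involves only the terms of
    degrees 0 and 1 of the maps at hand.

    Applied to the Rota-Baxter identity for [Tt], this is the linearisation of
    the quadratic equation for [T] in the direction [T_1]. When the terms
    containing [T] outermost are moved to the left, they complete the brackets
    [[T u, T_1 v]] and [[T_1 u, T v]] to the two induced actions of [h_T] on
    [g], and the linearisation becomes [delta T_1 = 0]
    (see [relRB_linearization] and [leib_diff1]).

    Applied to [Phi (Tt u) = Tt' (Psi u)], it gives
    [T_1 u - T'_1 u = - ([x0, T u] - T (rho^L (x0, u)))], which is
    [- varrho^R (x0, u)], the value at [u] of the differential of the 0-cochain
    [x0] (see [equivalence_linearization] and [leib_diff0]). *)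

Set Implicit Arguments.
Unset Strict Implicit.
Unset Printing Implicit Defensive.

Import GRing.Theory.
Local Open Scope ring_scope.

Section Coefficients.
Variable R : comNzRingType.

Lemma pscoef0_psconv U V (W : zmodType) (B : U -> V -> W) a b :
  pscoef (psconv B a b) 0 = B (pscoef a 0%N) (pscoef b 0%N).
Proof. by rewrite /= big_ord1. Qed.

Lemma pscoef1_psconv U V (W : zmodType) (B : U -> V -> W) a b :
  pscoef (psconv B a b) 1 =
  B (pscoef a 0%N) (pscoef b 1%N) + B (pscoef a 1%N) (pscoef b 0%N).
Proof. by rewrite /= big_ord_recl big_ord1. Qed.

Lemma psconv_psCr U (V W : zmodType) (B : U -> V -> W) a y n :
    (forall x, B x 0 = 0) ->
  pscoef (psconv B a (psC y)) n = B (pscoef a n) y.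
Proof.
move=> B0; rewrite /= big_ord_recr /= subnn big1 ?add0r // => i _.
by rewrite subn_eq0 leqNgt ltn_ord B0.
Qed.

Lemma pscoef_psmap_psC (U V : lmodType R) (F : powser {linear U -> V}) u n :
  pscoef (psmap F (psC u)) n = pscoef F n u.
Proof. by apply: psconv_psCr => f; apply: linear0. Qed.

Lemma pscoef1_psmap (U V : lmodType R) (F : powser {linear U -> V}) a :
  pscoef (psmap F a) 1 =
  pscoef F 0%N (pscoef a 1%N) + pscoef F 1%N (pscoef a 0%N).
Proof. exact: pscoef1_psconv. Qed.

Lemma pscoef_psC_scale (V : lmodType R) (c : R) (a : powser V) n :
  pscoef (psC c *: a) n = c *: pscoef a n.
Proof. by apply: (psconv_psCl (B := *:%R)) => y; apply: scale0r. Qed.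

End Coefficients.

Section LowDegreeDifferential.
Variables (R : comNzRingType) (L : leibnizType R) (V : lmodType R).
Variable rho : representation L V.

(** Only the right action survives in degree 0, so 1-coboundaries are the maps
    [- rho^R (x, -)]. *)
Lemma leib_diff0 (c : {ffun 'I_0 -> L} -> V) u :
  leib_diff rho c u = - repR rho (c (fdel u ord_max)) (u ord0).
Proof.
rewrite /leib_diff big_pred0 // add0r expr1 scaleN1r big_ord1 big1 ?addr0.
  by rewrite [ord_max]ord1.
by move=> j; rewrite (ord1 j).
Qed.

(** For linear [f], the 1-cocycle condition says that [f] is a derivation of
    [L] with values in [V]. *)
Lemma leib_diff1 (f : L -> V) (u : {ffun 'I_2 -> L}) :
  leib_diff rho (fun w : {ffun 'I_1 -> L} => f (w ord0)) u =
  repL rho (u ord0) (f (u ord_max)) + repR rho (f (u ord0)) (u ord_max)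
  - f ⟦u ord0, u ord_max⟧.
Proof.
have lift00 : lift ord0 ord0 = ord_max :> 'I_2 by apply: val_inj.
have lift10 : lift ord_max ord0 = ord0 :> 'I_2 by apply: val_inj.
rewrite /leib_diff big_mkcond !big_ord_recl !big_ord0 /=.
rewrite big_mkcond !big_ord_recl big_ord0 /=.
rewrite [X in _ + (_ + (X + _))]big_pred0; last by case=> [[|[]]].
rewrite /fdel /fupd !addr0 add0r !ffunE lift00 lift10 eqxx /=.
by rewrite expr0 expr1 sqrrN expr1n !scale1r scaleN1r.
Qed.

Lemma multilinear1 (f : {linear L -> V}) :
  multilinear (fun w : {ffun 'I_1 -> L} => f (w ord0)).
Proof.
by move=> u i a x y; rewrite !ffunE (ord1 i) eqxx linearP.
Qed.

End LowDegreeDifferential.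

Section Linearization.
Variables (R : comNzRingType) (g h : leibnizType R) (rho : leibnizRep g h).
Variables (lam : R) (T : relRB rho lam).

(** The two inner [T1] on the right come from the actions of [T u] and [T v],
    which are themselves deformed; the term [T1 (induced_bracket T u v)] is
    the deformation of the outer [T]. *)
Lemma relRB_linearization (Tt : powser {linear h -> g}) u v :
    formal_deformation T Tt ->
  let T1 := pscoef Tt 1%N in
  ⟦T u, T1 v⟧ + ⟦T1 u, T v⟧ =
  T (repL rho (T1 u) v + repR rho u (T1 v)) + T1 (induced_bracket T u v).
Proof.
case=> T0 RB_Tt /=.
have /psP/(_ 1%N) := RB_Tt (psC u) (psC v).
rewrite pscoef1_psconv !pscoef_psmap_psC !T0 => ->.
rewrite pscoef1_psmap T0 !pscoefD !pscoef_psC_scale.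
rewrite !(pscoef1_psconv, pscoef0_psconv) /= !T0 (linear0 T).
by rewrite !(linear0l, linear0r) !(addr0, add0r) scaler0 addr0.
Qed.

(** The element [x0] that generates the first-order part of the equivalence is
    the 0-cochain bounding the difference. *)
Lemma equivalence_linearization (Tt Tt' : powser {linear h -> g}) :
    formal_deformation T Tt -> formal_deformation T Tt' ->
    equivalent_deformations rho Tt Tt' ->
  exists x0 : g, forall u : h,
    pscoef Tt 1%N u - pscoef Tt' 1%N u = - induced_repR T x0 u.
Proof.
move=> [T0 _] [T0' _] [x0] [Phi] [Psi] [Phi0 Phi1 Psi0 Psi1 [_ _ PhiT _ _]].
exists x0 => u; have /psP/(_ 1%N) := PhiT (psC u).
rewrite (pscoef1_psmap Phi) (pscoef1_psmap Tt') !pscoef_psmap_psC.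
rewrite Phi0 Phi1 Psi0 Psi1 T0 T0' => eqT1.
rewrite /induced_repR opprB; apply/eqP.
by rewrite subr_eq addrAC eq_sym subr_eq eqT1.
Qed.

Lemma deformation_cocycle (Tt : powser {linear h -> g}) :
    formal_deformation T Tt ->
  cocycle (induced_rep T) (cochain1 T (pscoef Tt 1%N)).
Proof.
move=> defTt; split=> [|w].
  exact: (@multilinear1 R (induced T) g (pscoef Tt 1%N)).
rewrite (@leib_diff1 R (induced T) g (induced_rep T) (pscoef Tt 1%N)).
apply/eqP; rewrite subr_eq0; apply/eqP.
have /= lin := relRB_linearization (w ord0) (w ord_max) defTt.
rewrite /= /induced_repL /induced_repR addrACA lin -opprD -(linearD T).
by rewrite [repR rho _ _ + _]addrC addrAC subrr add0r.
Qed.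

Lemma equivalent_cohomologous (Tt Tt' : powser {linear h -> g}) :
    formal_deformation T Tt -> formal_deformation T Tt' ->
    equivalent_deformations rho Tt Tt' ->
  cohomologous (induced_rep T)
    (cochain1 T (pscoef Tt 1%N)) (cochain1 T (pscoef Tt' 1%N)).
Proof.
move=> defTt defTt' eqTt; split; [exact: deformation_cocycle.. |].
have [x0 eqT1] := equivalence_linearization defTt defTt' eqTt.
exists (fun=> x0) => [u [] // | w].
by rewrite leib_diff0; apply: eqT1.
Qed.

End Linearization.

Theorem theorem5p3 (k : fieldType) (char0 : [pchar k] =i pred0) (lam : k)
    (g h : leibnizType k) (rho : leibnizRep g h) (T : relRB rho lam) :
  (forall Tt : powser {linear h -> g}, formal_deformation T Tt ->
     cocycle (induced_rep T) (cochain1 T (pscoef Tt 1%N))) /\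
  (forall Tt Tt' : powser {linear h -> g},
     formal_deformation T Tt -> formal_deformation T Tt' ->
     equivalent_deformations rho Tt Tt' ->
     cohomologous (induced_rep T)
       (cochain1 T (pscoef Tt 1%N)) (cochain1 T (pscoef Tt' 1%N))).
Proof.
split=> [Tt | Tt Tt']; first exact: deformation_cocycle.
exact: equivalent_cohomologous.
Qed.
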